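(* Let $R\to S$ be a ring homomorphism making $S$ a faithfully flat right $R$-module, $n\ge 0$ an integer, $M$ an $R$-module and $\mathscr{X}$ a class of submodules of $M$. Then: (1) $M$ is $n$-$\mathscr{X}$-coherent if $S\otimes_R M$ is an $n$-${}^{S\otimes}\mathscr{X}$-coherent $S$-module. (2) $M$ is $n$-$\mathscr{X}$-coherent if and only if $S\otimes_R M$ is an $n$-${}^{S\otimes}\mathscr{X}_{n-1}$-coherent $S$-module.
   Context: Rings are associative with identity (not necessarily commutative); modules are unital left modules unless specified otherwise. For an integer $k\ge 0$, a module $M$ is $k$-presented if there is an exact sequence $F_k\to F_{k-1}\to\cdots\to F_0\to M\to 0$ with each $F_i$ a finitely generated free module (over the ring in question); every module is regarded as $(-1)$-presented. For a class $\mathscr{X}$ of modules, $\mathscr{X}_k$ denotes the class of $k$-presented modules in $\mathscr{X}$. If $\mathscr{X}$ is a class of submodules of a module $M$, then $M$ is $n$-$\mathscr{X}$-coherent if $\mathscr{X}_{n-1}$ is nonempty and every module in $\mathscr{X}_{n-1}$ is in $\mathscr{X}_n$. ${}^{S\otimes}\mathscr{X}$ denotes the class $\{S\otimes_R N : N\in\mathscr{X}\}$ of submodules of $S\otimes_R M$, and ${}^{S\otimes}\mathscr{X}_{n-1}$ denotes the class $\{S\otimes_R N : N\in\mathscr{X}_{n-1}\}$. *)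

(* Defs.v *)
From HB Require Import structures.
From mathcomp Require Import all_boot all_algebra.
From mathcomp Require Import boolp classical_sets.
From mathcomp.multinomials Require Import freeg.

Set Implicit Arguments.
Unset Strict Implicit.
Unset Printing Implicit Defensive.

Import GRing.Theory.

Local Open Scope ring_scope.
Local Open Scope quotient_scope.
Local Open Scope classical_set_scope.

(* Right R-modules are left modules over the converse ring R^c: for r : R^c,
   r *: a is the right action of r on a. *)
Section Tensor.
Variables (R : pzRingType) (A : lmodType R^c) (M : lmodType R).

Definition balanced (Z : zmodType) (b : A -> M -> Z) : Prop :=
  [/\ forall a a' m, b (a + a') m = b a m + b a' m,
      forall a m m', b a (m + m') = b a m + b a m' &
      forall (r : R) a m, b ((r : R^c) *: a) m = b a (r *: m)].

Let F := {freeg (A * M)}.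
Let gen (a : A) (m : M) : F := << (a, m) >>.

Inductive tensor_relator : F -> Prop :=
| RelDl a a' m : tensor_relator (gen (a + a') m - gen a m - gen a' m)
| RelDr a m m' : tensor_relator (gen a (m + m') - gen a m - gen a m')
| RelZ (r : R) a m :
    tensor_relator (gen ((r : R^c) *: a) m - gen a (r *: m)).

(* The subgroup of F generated by the relators. *)
Definition tensor_relations : {pred F} := fun x =>
  `[< forall J : zmodClosed F, (forall y, tensor_relator y -> y \in J) ->
        x \in J >].

Lemma tensor_relations_zmod_closed : zmod_closed tensor_relations.
Proof.
split=> [|x y /asboolP xI /asboolP yI]; apply/asboolP => J relJ.
  exact: rpred0.
by apply: rpredB; [exact: xI|exact: yI].
Qed.

HB.instance Definition _ :=
  GRing.isZmodClosed.Build F tensor_relations tensor_relations_zmod_closed.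

Definition tensor : Type := Quotient.quot tensor_relations.

HB.instance Definition _ := GRing.Zmodule.on tensor.

Definition tens (a : A) (m : M) : tensor :=
  \pi_(Quotient.quot tensor_relations) (gen a m).

Lemma pi_tensor_eq (x y : F) :
  x - y \in tensor_relations ->
  \pi_(Quotient.quot tensor_relations) x = \pi_(Quotient.quot tensor_relations) y.
Proof. by move=> xy; apply/eqP; rewrite -Quotient.idealrBE. Qed.

Lemma tens_balanced : balanced tens.
Proof.
split=> [a a' m|a m m'|r a m]; rewrite /tens -?[_ + _ in RHS]raddfD;
  apply: pi_tensor_eq; apply/asboolP => J relJ; apply: relJ.
- by rewrite opprD addrA; exact: RelDl.
- by rewrite opprD addrA; exact: RelDr.
- exact: RelZ.
Qed.

Lemma tensor_ind (P : tensor -> Prop) :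
    (forall a m, P (tens a m)) -> (forall x y, P x -> P y -> P (x - y)) ->
  forall t, P t.
Proof.
move=> Pt PB t; have P0 : P 0 by rewrite -(subrr (tens 0 0)); exact: PB.
have PN x : P x -> P (- x) by move=> Px; rewrite -sub0r; exact: PB.
have PD x y : P x -> P y -> P (x + y).
  by move=> Px Py; rewrite -[y]opprK; apply: PB => //; exact: PN.
elim/quotW: t => x; rewrite -(freeg_sumE x) raddf_sum.
elim/big_ind: _ => // -[a m] _; set k := coeff _ _.
rewrite -[k](intz k) -[k%:~R]mulr1z -freegU_mulz.
rewrite raddfMz; change (P (tens a m *~ k)).
have PM n : P (tens a m *+ n) by elim: n => // n IH; rewrite mulrS; exact: PD.
by case: k => n; [exact: PM|rewrite NegzE mulrNz; apply: PN; exact: PM].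
Qed.

Definition tensor_lift (Z : zmodType) (b : A -> M -> Z) (t : tensor) : Z :=
  @fglift int (zmodule Z) (A * M)%type (fun p => b p.1 p.2)
    (repr (t : Quotient.quot tensor_relations)).

Section Lift.
Variables (Z : zmodType) (b : A -> M -> Z).
Hypothesis bal : balanced b.

Let L : F -> Z := @fglift int (zmodule Z) (A * M)%type (fun p => b p.1 p.2).

Let L_morph : zmod_morphism L.
Proof.
exact: (@lift_is_additive int (A * M)%type (zmodule Z)
          (fun p => b p.1 p.2)).
Qed.

HB.instance Definition _ := GRing.isZmodMorphism.Build F Z L L_morph.

Let L_gen a m : L (gen a m) = b a m.
Proof. by rewrite /L /gen liftU scale1r. Qed.

Let ker : {pred F} := fun x => L x == 0.

Let ker_closed : zmod_closed ker.
Proof.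
split=> [|x y /eqP xI /eqP yI]; rewrite unfold_in /ker; first by rewrite raddf0.
by rewrite raddfB/= xI yI subrr.
Qed.

HB.instance Definition _ := GRing.isZmodClosed.Build F ker ker_closed.

Let L_repr (x : F) :
  tensor_lift b (\pi_(Quotient.quot tensor_relations) x) = L x.
Proof.
set q := \pi_ _ x; rewrite /tensor_lift -/(L _); apply/eqP; rewrite -subr_eq0 -raddfB.
have /asboolP rel : repr q - x \in tensor_relations.
  by rewrite Quotient.idealrBE reprK.
have := rel ker; rewrite unfold_in; apply => y; rewrite unfold_in.
case: bal => bDl bDr bZ; case=> *; rewrite /ker !raddfB /= !L_gen.
- by rewrite bDl addrAC addrK subrr.
- by rewrite bDr addrAC addrK subrr.
- by rewrite bZ subrr.
Qed.

Lemma tensor_lift_tens a m : tensor_lift b (tens a m) = b a m.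
Proof. by rewrite L_repr L_gen. Qed.

Lemma tensor_lift_is_zmod_morphism : zmod_morphism (tensor_lift b).
Proof.
elim/quotW=> x; elim/quotW=> y; rewrite -[_ - _]raddfB.
by rewrite !L_repr raddfB.
Qed.

End Lift.

Lemma tensor_morph_ext (Z : zmodType) (g h : {additive tensor -> Z}) :
  (forall a m, g (tens a m) = h (tens a m)) -> g =1 h.
Proof.
by move=> gh; elim/tensor_ind=> // x y gx gy; rewrite !raddfB gx gy.
Qed.

End Tensor.

Section TensorMap.
Variables (R : pzRingType) (A : lmodType R^c) (M N : lmodType R).
Variable g : {linear M -> N}.

Definition tensor_map : tensor A M -> tensor A N :=
  tensor_lift (fun a m => tens a (g m)).

Lemma tensor_map_balanced : balanced (fun a m => tens a (g m) : tensor A N).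
Proof.
by case: (@tens_balanced R A N) => tDl tDr tZ; split=> *;
  rewrite ?linearD ?linearZ.
Qed.

HB.instance Definition _ := GRing.isZmodMorphism.Build _ _ tensor_map
  (tensor_lift_is_zmod_morphism tensor_map_balanced).

Lemma tensor_map_tens a m : tensor_map (tens a m) = tens a (g m).
Proof. exact: (tensor_lift_tens tensor_map_balanced). Qed.

End TensorMap.

Definition exact_at (T U : Type) (V : zmodType) (g : T -> U) (h : U -> V) : Prop :=
  forall y, h y = 0 <-> exists x, g x = y.

Definition faithfully_flat (R : pzRingType) (A : lmodType R^c) : Prop :=
  forall (N1 N2 N3 : lmodType R) (g : {linear N1 -> N2}) (h : {linear N2 -> N3}),
    exact_at g h <->
    exact_at (@tensor_map R A _ _ g) (@tensor_map R A _ _ h).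

Definition right_module (R S : pzRingType) (f : {rmorphism R -> S}) : Type := S.

Section RightModule.
Variables (R S : pzRingType) (f : {rmorphism R -> S}).

HB.instance Definition _ := GRing.Zmodule.on (right_module f).

Definition right_scale (r : R^c) (s : right_module f) : right_module f :=
  (s : S) * f r.

Let right_scaleA a b v :
  right_scale a (right_scale b v) = right_scale (a * b) v.
Proof. by rewrite /right_scale rmorphM mulrA. Qed.

Let right_scale1 : left_id 1 right_scale.
Proof. by move=> v; rewrite /right_scale rmorph1 mulr1. Qed.

Let right_scaleDr : right_distributive right_scale +%R.
Proof. by move=> a u v; rewrite /right_scale -mulrDl. Qed.

Let right_scaleDl v : {morph right_scale^~ v : a b / a + b}.
Proof. by move=> a b; rewrite /right_scale rmorphD mulrDr. Qed.

HB.instance Definition _ := GRing.Zmodule_isLmodule.Build R^c (right_module f)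
  right_scaleA right_scale1 right_scaleDr right_scaleDl.

End RightModule.

(* base_change f M is S (x)_R M with its left S-action. *)
Section BaseChange.
Variables (R S : pzRingType) (f : {rmorphism R -> S}) (M : lmodType R).

Definition base_change : Type := tensor (right_module f) M.

HB.instance Definition _ := GRing.Zmodule.on base_change.

Definition base_tens (s : S) (m : M) : base_change :=
  tens (s : right_module f) m.

Lemma base_change_ind (P : base_change -> Prop) :
    (forall s m, P (base_tens s m)) -> (forall x y, P x -> P y -> P (x - y)) ->
  forall t, P t.
Proof. exact: (@tensor_ind R (right_module f) M). Qed.

Definition base_scale (s : S) : base_change -> base_change :=
  tensor_lift (fun (s' : right_module f) m => base_tens (s * s') m).

Let base_scale_balanced s :
  balanced (fun (s' : right_module f) m => base_tens (s * s') m).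
Proof.
case: (@tens_balanced R (right_module f) M) => tDl tDr tZ.
split=> [a a' m|a m m'|r a m]; rewrite /base_tens.
- by rewrite mulrDr; exact: tDl.
- exact: tDr.
- by rewrite -tZ; congr tens; rewrite /GRing.scale /= /right_scale mulrA.
Qed.

Lemma base_scale_tens s s' m :
  base_scale s (base_tens s' m) = base_tens (s * s') m.
Proof. exact: (tensor_lift_tens (base_scale_balanced s)). Qed.

Let base_scaleB s : zmod_morphism (base_scale s).
Proof. exact: (tensor_lift_is_zmod_morphism (base_scale_balanced s)). Qed.

HB.instance Definition _ s :=
  GRing.isZmodMorphism.Build base_change base_change (base_scale s)
    (base_scaleB s).

Let base_scaleA s s' v : base_scale s (base_scale s' v) = base_scale (s * s') v.
Proof.
elim/base_change_ind: v => [a m|x y xE yE]; last by rewrite !raddfB/= xE yE.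
by rewrite !base_scale_tens mulrA.
Qed.

Let base_scale1 : left_id 1 base_scale.
Proof.
elim/base_change_ind=> [a m|x y xE yE]; last by rewrite base_scaleB xE yE.
by rewrite base_scale_tens mul1r.
Qed.

Let base_scaleDr : right_distributive base_scale +%R.
Proof. by move=> s u v; rewrite raddfD. Qed.

Let base_scaleDl v : {morph base_scale^~ v : s s' / s + s'}.
Proof.
move=> s s'; elim/base_change_ind: v => [a m|x y xE yE].
  rewrite !base_scale_tens mulrDl.
  by case: (@tens_balanced R (right_module f) M) => tDl _ _; exact: tDl.
by rewrite !raddfB/= xE yE opprD addrACA.
Qed.

HB.instance Definition _ := GRing.Zmodule_isLmodule.Build S base_change
  base_scaleA base_scale1 base_scaleDr base_scaleDl.

Lemma base_tensZ s s' m : s *: base_tens s' m = base_tens (s * s') m.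
Proof. exact: base_scale_tens. Qed.

End BaseChange.

Section BaseChangeMap.
Variables (R S : pzRingType) (f : {rmorphism R -> S}) (M N : lmodType R).
Variable g : {linear M -> N}.

Definition base_map : base_change f M -> base_change f N :=
  @tensor_map R (right_module f) M N g.

Lemma base_map_tens s m : base_map (base_tens f s m) = base_tens f s (g m).
Proof. exact: tensor_map_tens. Qed.

Let base_mapB : zmod_morphism base_map.
Proof. by move=> x y; exact: (raddfB (@tensor_map R (right_module f) M N g)). Qed.

HB.instance Definition _ :=
  GRing.isZmodMorphism.Build (base_change f M) (base_change f N) base_map
    base_mapB.

Let base_map_scalable : scalable base_map.
Proof.
move=> s; elim/base_change_ind=> [a m|x y xE yE].
  by rewrite base_tensZ !base_map_tens base_tensZ.
by rewrite scalerBr !base_mapB xE yE scalerBr.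
Qed.

HB.instance Definition _ :=
  GRing.isScalable.Build S (base_change f M) (base_change f N) _ base_map
    base_map_scalable.

End BaseChangeMap.

Arguments base_map {R S} f {M N} g _.

Section Submodule.
Variables (R : pzRingType) (M : lmodType R) (N : submodClosed M).

Record submodule : Type := Submodule { submodule_val : M; _ : submodule_val \in N }.

HB.instance Definition _ := [isSub for submodule_val].
HB.instance Definition _ := [Choice of submodule by <:].
HB.instance Definition _ := [SubChoice_isSubLmodule of submodule by <:].

End Submodule.

(* S (x)_R N as a submodule of S (x)_R M: the image of the map induced by the
   inclusion of N, which is injective whenever S is flat over R. *)
Section BaseChangeSubmodule.
Variables (R S : pzRingType) (f : {rmorphism R -> S}) (M : lmodType R).
Variable N : submodClosed M.

Definition base_submodule : {pred base_change f M} := fun t =>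
  `[< exists u : base_change f (submodule N),
        base_map f (\val : submodule N -> M) u = t >].

Lemma base_submodule_closed : submod_closed base_submodule.
Proof.
split=> [|s x y /asboolP[u <-] /asboolP[v <-]]; apply/asboolP.
  by exists 0; rewrite raddf0.
by exists (s *: u + v); rewrite linearP.
Qed.

HB.instance Definition _ :=
  GRing.isSubmodClosed.Build S (base_change f M) base_submodule
    base_submodule_closed.

End BaseChangeSubmodule.

Arguments base_submodule {R S} f {M} N _.

Definition finitely_generated_free (R : pzRingType) (F : lmodType R) : Prop :=
  exists (n : nat) (e : {linear 'rV[R]_n -> F}), bijective e.

Definition presented_nat (R : pzRingType) (k : nat) (M : lmodType R) : Prop :=
  exists (F : nat -> lmodType R) (d : forall i, {linear F i.+1 -> F i})
         (p : {linear F 0%N -> M}),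
    [/\ forall i, (i <= k)%N -> finitely_generated_free (F i),
        forall m, exists x, p x = m,
        (0 < k)%N -> exact_at (d 0%N) p &
        forall i, (i.+1 < k)%N -> exact_at (d i.+1) (d i)].

(* Every module is (-1)-presented; no other negative value is used. *)
Definition presented (R : pzRingType) (k : int) (M : lmodType R) : Prop :=
  if k is Posz k' then presented_nat k' M else True.

Definition presented_class (R : pzRingType) (M : lmodType R)
    (X : set (submodClosed M)) (k : int) : set (submodClosed M) :=
  [set N | X N /\ presented k (submodule N)].

Definition coherent (R : pzRingType) (n : nat) (M : lmodType R)
    (X : set (submodClosed M)) : Prop :=
  presented_class X (n%:Z - 1) !=set0 /\
  presented_class X (n%:Z - 1) `<=` presented_class X n%:Z.

Definition base_change_class (R S : pzRingType) (f : {rmorphism R -> S})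
    (M : lmodType R) (X : set (submodClosed M)) :
    set (submodClosed (base_change f M)) :=
  [set (base_submodule f N : submodClosed (base_change f M)) | N in X].

Arguments base_change_class {R S} f {M} X _.

(* Main.v *)
(** Faithful flatness makes k-presentation pass between N and S (x) N in both
    directions.  Ascent tensors a resolution.  For descent, generators of
    S (x) N involve finitely many elements of N, and these give a map R^m -> N
    that is onto after tensoring, hence onto; by Schanuel's argument the kernel
    of S^m -> S (x) N, which is S (x) K for K the kernel of R^m -> N, is
    (k-1)-presented, and one recurses on K. *)
Require Import Defs.
From mathcomp Require Import all_boot all_algebra.
From mathcomp Require Import boolp classical_sets.
From HB Require Import structures.

Set Implicit Arguments.
Unset Strict Implicit.
Unset Printing Implicit Defensive.

Import GRing.Theory.

Local Open Scope ring_scope.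

(** * Linear maps, kernels and finitely generated free modules *)

Section LinearMaps.
Variable R : pzRingType.

Definition linear_of (U V : lmodType R) (g : U -> V) (gP : linear g) :
    {linear U -> V} :=
  HB.pack_for {linear U -> V} g (GRing.isLinear.Build R U V *:%R g gP).

(** Injectivity of [i] makes the chosen preimages unique, hence linear in [w]. Maps into kernels are
    built this way below. *)
Lemma factor_through (U V W : lmodType R) (i : {linear U -> V})
    (g : {linear W -> V}) :
  injective i -> (forall w, exists u, i u = g w) ->
  exists h : {linear W -> U}, forall w, i (h w) = g w.
Proof.
move=> i_inj /choice[h hE].
have h_lin : linear h by move=> a x y; apply: i_inj; rewrite !linearP !hE linearP.
by exists (linear_of h_lin).
Qed.

Definition kernel (U V : lmodType R) (p : {linear U -> V}) : {pred U} :=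
  fun x => p x == 0.

Lemma kernel_submod_closed (U V : lmodType R) (p : {linear U -> V}) :
  submod_closed (kernel p).
Proof.
split=> [|a x y]; first by rewrite unfold_in /kernel linear0.
by rewrite !unfold_in /kernel linearP => /eqP-> /eqP->; rewrite scaler0 addr0.
Qed.

HB.instance Definition _ (U V : lmodType R) (p : {linear U -> V}) :=
  GRing.isSubmodClosed.Build R U (kernel p) (kernel_submod_closed p).

Lemma exact_kernel (U V : lmodType R) (p : {linear U -> V}) :
  exact_at (\val : submodule (kernel p) -> U) p.
Proof.
move=> y; split=> [py0|[x <-]]; last exact/eqP/(valP x).
have yK : y \in kernel p by apply/eqP.
by exists (Submodule yK).
Qed.

Definition short_exact (U V W : lmodType R) (i : U -> V) (p : V -> W) : Prop :=
  [/\ injective i, exact_at i p & forall w, exists v, p v = w].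

Lemma short_exact_kernel (U V : lmodType R) (p : {linear U -> V}) :
  (forall v, exists u, p u = v) ->
  short_exact (\val : submodule (kernel p) -> U) p.
Proof. by split=> //; [exact: val_inj|exact: exact_kernel]. Qed.

Lemma bijective_inverse (U V : lmodType R) (e : {linear U -> V}) :
  bijective e -> exists g : {linear V -> U}, cancel e g /\ cancel g e.
Proof.
move=> [g eK gK]; have g_lin : linear g.
  by move=> a x y; apply: (can_inj eK); rewrite linearP !gK.
by exists (linear_of g_lin).
Qed.

Lemma bijectiveP (U V : lmodType R) (e : {linear U -> V}) :
  injective e -> (forall v, exists u, e u = v) -> bijective e.
Proof. by move=> e_inj /choice[g gK]; exists g => // x; apply: e_inj. Qed.

(** The linear map out of R^n that sends the [j]-th basis vector to [v j]. *)
Definition row_comb (V : lmodType R) n (v : 'I_n -> V) (x : 'rV[R]_n) : V :=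
  \sum_j x 0 j *: v j.

Lemma row_comb_linear (V : lmodType R) n (v : 'I_n -> V) : linear (row_comb v).
Proof.
move=> a x y; rewrite /row_comb scaler_sumr -big_split; apply: eq_bigr => j _.
by rewrite !mxE scalerDl scalerA.
Qed.

HB.instance Definition _ (V : lmodType R) n (v : 'I_n -> V) :=
  GRing.isLinear.Build R 'rV[R]_n V *:%R (row_comb v) (row_comb_linear v).

Lemma linear_row_comb (V : lmodType R) n (g : {linear 'rV[R]_n -> V}) x :
  g x = row_comb (fun j => g (delta_mx 0 j)) x.
Proof.
rewrite [x in LHS]row_sum_delta linear_sum; apply: eq_bigr => j _.
by rewrite linearZ.
Qed.

(** Projectivity of free modules: lift the images of a basis and extend linearly. *)
Lemma free_lift (F V W : lmodType R) (p : {linear V -> W}) (g : {linear F -> W}) :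
  finitely_generated_free F -> (forall w, exists v, p v = w) ->
  exists h : {linear F -> V}, forall x, p (h x) = g x.
Proof.
move=> [n [e /bijective_inverse[e' [eK e'K]]]] /choice[s sK].
exists (row_comb (fun j => s (g (e (delta_mx 0 j)))) \o e' : {linear F -> V}) => x.
rewrite -[in RHS](e'K x) -[RHS]/((g \o e) (e' x)) linear_row_comb /= linear_sum.
by apply: eq_bigr => j _; rewrite linearZ /= sK.
Qed.

Lemma free_prod (F G : lmodType R) :
  finitely_generated_free F -> finitely_generated_free G ->
  finitely_generated_free (F * G)%type.
Proof.
move=> [m [e e_bij]] [n [e' e'_bij]].
pose h (x : 'rV[R]_(m + n)) := (e (lsubmx x), e' (rsubmx x)).
have h_lin : linear h by move=> a x y; rewrite /h !linearP.
exists (m + n)%N, (linear_of h_lin).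
have [[g eK gK] [g' e'K g'K]] := (e_bij, e'_bij).
exists (fun z => row_mx (g z.1) (g' z.2)) => [x|[y z]] /=.
  by rewrite /h /= eK e'K hsubmxK.
by rewrite /h /= row_mxKl row_mxKr gK g'K.
Qed.

Lemma free_row n : finitely_generated_free 'rV[R]_n.
Proof. by exists n, idfun; exists id. Qed.

End LinearMaps.

(** * Finite free resolutions, built one syzygy at a time *)

Section Resolutions.
Variable R : pzRingType.

(* [resolved k] means [(k - 1)]-presented; the shift makes the base case the
   vacuous (-1)-presentation. *)
Fixpoint resolved (k : nat) (M : lmodType R) : Prop :=
  if k is k'.+1 then
    exists (F K : lmodType R) (i : {linear K -> F}) (p : {linear F -> M}),
      [/\ finitely_generated_free F, short_exact i p & resolved k' K]
  else True.

Lemma resolved_iso k (M N : lmodType R) (e : {linear M -> N}) :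
  bijective e -> resolved k M -> resolved k N.
Proof.
case: k => // k [g eK gK] [F [K [i [p [Ffree [i_inj ip p_surj] Kk]]]]].
exists F, K, i, (e \o p : {linear F -> N}); split=> //; split=> // [y|w] /=.
  rewrite -ip; split=> [/(congr1 g)|->]; last by rewrite linear0.
  by rewrite eK => ->; apply: (can_inj eK); rewrite gK linear0.
by have [x xE] := p_surj (g w); exists x; rewrite xE gK.
Qed.

(** The identity covers [F], and its kernel R^0 is free again, so the induction continues. *)
Lemma free_resolved k (F : lmodType R) : finitely_generated_free F -> resolved k F.
Proof.
elim: k F => // k IH F Ffree.
exists F, 'rV[R]_0, \0, idfun; split=> //; last by apply: IH; exact: free_row.
split=> [x y _|y|y]; [|split=> [/= ->|[x <-] //]; by exists 0|by exists y].
by rewrite [x]thinmx0 [y]thinmx0.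
Qed.

(** Horseshoe argument: covers of [A] and [C] combine into a cover of [B] whose kernel is an
    extension of [KC] by [KA]. *)
Lemma resolved_extension k (A B C : lmodType R) (i : {linear A -> B})
    (p : {linear B -> C}) :
  short_exact i p -> resolved k A -> resolved k C -> resolved k B.
Proof.
elim: k A B C i p => // k IH A B C i p [i_inj ip p_surj].
move=> [FA [KA [jA [qA [FAfree [jA_inj jqA qA_surj] KAk]]]]].
move=> [FC [KC [jC [qC [FCfree [jC_inj jqC qC_surj] KCk]]]]].
have [s sE] := free_lift qC FCfree p_surj.
have pi0 a : p (i a) = 0 by apply/ip; exists a.
have q_lin : linear (fun z : (FA * FC)%type => i (qA z.1) + s z.2).
  by move=> a x y; rewrite /= !linearP /= scalerDr addrACA.
pose q := linear_of q_lin.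
(* If [y] lies over [p b], then [b - s y] comes from [A] and is reached by [FA]. *)
have q_surj b : exists z, q z = b.
  have [y yE] := qC_surj (p b).
  have /ip[a aE] : p (b - s y) = 0 by rewrite linearB /= sE yE subrr.
  have [x xE] := qA_surj a.
  by exists (x, y); rewrite /= xE aE subrK.
have [j_inj jq _] := short_exact_kernel q_surj.
set K := submodule (kernel q) in j_inj jq.
pose j : {linear K -> _} := \val.
have l_lin : linear (fun x => (jA x, 0) : (FA * FC)%type).
  by move=> a x y; rewrite linearP; congr pair; rewrite /= scaler0 addr0.
have [u uE] : exists u : {linear KA -> K}, forall x, j (u x) = (jA x, 0).
  apply: (@factor_through _ _ _ _ j (linear_of l_lin)) => // x; apply/jq => /=.
  by rewrite linear0 addr0 (jqA _).2 ?linear0//; exists x.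
have [v vE] : exists v : {linear K -> KC}, forall z, jC (v z) = (j z).2.
  apply: (@factor_through _ _ _ _ jC (snd \o j : {linear K -> FC})) => // z; apply/jqC.
  have := congr1 p ((jq (j z)).2 (ex_intro _ z erefl)).
  by rewrite /= linearD /= pi0 add0r sE linear0.
exists (FA * FC)%type, K, j, q; split=> //; first exact: free_prod.
(* It remains to see that 0 -> KA -> K -> KC -> 0 is exact. *)
apply: (IH _ _ _ u v) => //; split.
- by move=> x y /(congr1 j); rewrite !uE => -[/jA_inj].
- move=> z; split=> [vz0|[x <-]]; last by apply: jC_inj; rewrite vE uE linear0.
  have jz2 : (j z).2 = 0 by rewrite -vE vz0 linear0.
  have : q (j z) = 0 by apply/jq; exists z.
  rewrite /= jz2 linear0 addr0 => qz0.
  have /jqA[x xE] : qA (j z).1 = 0 by apply: i_inj; rewrite qz0 linear0.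
  by exists x; apply: j_inj; rewrite [LHS]uE xE -[RHS]/(j z) (surjective_pairing (j z)) jz2.
- move=> y; have qy0 : qC (jC y) = 0 by apply/jqC; exists y.
  have /ip[a aE] : p (s (jC y)) = 0 by rewrite sE.
  have [x xE] := qA_surj a.
  (* The element [s (jC y)] equals [i (qA x)], so the first coordinate [- x] cancels it. *)
  have /jq[z zE] : q (- x, jC y) = 0.
    by rewrite /= !linearN /= xE aE addNr.
  by exists z; apply: jC_inj; rewrite vE [j z]zE.
Qed.

(** A cover [q] of [B] with kernel [L], followed by [p], covers [C]; the kernel [K] of the composite
    fits into 0 -> L -> K -> A -> 0, so the extension lemma applies. *)
Lemma resolved_quotient k (A B C : lmodType R) (i : {linear A -> B})
    (p : {linear B -> C}) :
  short_exact i p -> resolved k A -> resolved k.+1 B -> resolved k.+1 C.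
Proof.
move=> [i_inj ip p_surj] Ak [F [L [l [q [Ffree [l_inj lq q_surj] Lk]]]]].
pose r : {linear F -> C} := p \o q.
have r_surj c : exists x, r x = c.
  by have [b <-] := p_surj c; have [x <-] := q_surj b; exists x.
have [j_inj jr _] := short_exact_kernel r_surj.
set K := submodule (kernel r) in j_inj jr.
pose j : {linear K -> _} := \val.
have [u uE] : exists u : {linear L -> K}, forall x, j (u x) = l x.
  apply: factor_through => // x; apply/jr => /=.
  by rewrite (lq _).2 ?linear0//; exists x.
have [v vE] : exists v : {linear K -> A}, forall z, i (v z) = q (j z).
  apply: (@factor_through _ _ _ _ i (q \o j : {linear K -> B})) => // z; apply/ip.
  by apply/jr; exists z.
exists F, K, j, r; split=> //; apply: (@resolved_extension _ _ _ _ u v) => //; split.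
- by move=> x y /(congr1 j); rewrite !uE => /l_inj.
- move=> z; split=> [vz0|[x <-]].
    have /lq[x xE] : q (j z) = 0 by rewrite -vE vz0 linear0.
    by exists x; apply: j_inj; rewrite [LHS]uE.
  by apply: i_inj; rewrite vE uE linear0; apply/lq; exists x.
- move=> a; have [x xE] := q_surj (i a).
  have /jr[z zE] : r x = 0 by rewrite /= xE; apply/ip; exists a.
  by exists z; apply: i_inj; rewrite vE [j z]zE.
Qed.

(* Schanuel: two lifts [s : F -> P] and [t : P -> F] of the covers [q] and [p]
   give [0 -> F -> K' * P -> K -> 0], so that [K] inherits the resolution of
   [K'] without comparing whole resolutions. *)
Lemma resolved_syzygy k (K P M : lmodType R) (i : {linear K -> P})
    (p : {linear P -> M}) :
  finitely_generated_free P -> short_exact i p -> resolved k.+1 M -> resolved k K.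
Proof.
case: k => // k Pfree [i_inj ip p_surj].
move=> [F [K' [i' [q [Ffree [i'_inj iq q_surj] K'k]]]]].
have [s sE] := free_lift q Ffree p_surj.
have [t tE] := free_lift p Pfree q_surj.
have qi0 x : q (i' x) = 0 by apply/iq; exists x.
(* The map sends (x, y) to y - s (t y + i' x). It lands in the kernel of [p] because p s = q, q t =
   p and q i' = 0. *)
have g_lin : linear (fun z : (K' * P)%type => z.2 - s (t z.2) - s (i' z.1)).
  move=> a x y; rewrite /= !linearP /=.
  by rewrite 2!scalerDr [RHS]addrACA; congr (_ + _); exact: addrACA.
have [v vE] : exists v : {linear (K' * P)%type -> K},
    forall z, i (v z) = z.2 - s (t z.2) - s (i' z.1).
  apply: (@factor_through _ _ _ _ i (linear_of g_lin)) => // z; apply/ip => /=.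
  by rewrite !linearB /= !sE tE qi0 subrr subr0.
have [d dE] : exists d : {linear F -> K'}, forall y, i' (d y) = y - t (s y).
  have h_lin : linear (fun y : F => y - t (s y)).
    by move=> a x y; rewrite !linearP /= addrACA -scalerDr.
  apply: (@factor_through _ _ _ _ i' (linear_of h_lin)) => // y; apply/iq => /=.
  by rewrite linearB /= tE sE subrr.
have u_lin : linear (fun y : F => (d y, s y) : (K' * P)%type).
  by move=> a x y; rewrite !linearP.
apply: (@resolved_quotient _ _ _ _ (linear_of u_lin) v); first split.
- move=> x y [/(congr1 i') + sxy]; rewrite !dE sxy => /eqP.
  by rewrite (can_eq (addrNK _)) => /eqP.
- move=> [x y]; split=> [vz0|[w <-]]; last first.
    by apply: i_inj; rewrite vE linear0 /= dE linearB /= subrr.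
  (* Vanishing of [v (x, y)] says that w = t y + i' x satisfies s w = y; hence w - t (s w) = i' x,
     and [w] is the preimage. *)
  have sw : s (t y + i' x) = y.
    have := vE (x, y); rewrite vz0 linear0 /= -addrA -opprD -linearD.
    by move=> /esym/eqP; rewrite subr_eq0 => /eqP.
  exists (t y + i' x); rewrite /= sw; congr pair; apply: i'_inj.
  by rewrite dE sw addrC addKr.
- move=> w; have piw0 : p (i w) = 0 by apply/ip; exists w.
  (* With i' x = - t (i w), the two terms involving [s] cancel and [v (x, i w)] is [w]. *)
  have /iq[x xE] : q (- t (i w)) = 0 by rewrite linearN /= tE piw0 oppr0.
  by exists (x, i w); apply: i_inj; rewrite vE /= xE linearN opprK subrK.
- exact: free_resolved.
(* The product is an extension of the free module [P] by [K']. *)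
- have l_lin : linear (fun x : K' => (x, 0) : (K' * P)%type).
    by move=> a x y; congr pair; rewrite /= scaler0 addr0.
  apply: (@resolved_extension _ _ _ _ (linear_of l_lin) snd) => //; last first.
    exact: free_resolved.
  split=> [x y [] //|[x y]|y]; last by exists (0, y).
  by split=> [/= ->|[z <-]//]; exists x.
Qed.

(** A long exact sequence is cut at the kernel of its augmentation; conversely, a cover is spliced
    with a presentation of its kernel. *)
Lemma presented_natP k (M : lmodType R) : presented_nat k M <-> resolved k.+1 M.
Proof.
split.
  elim: k M => [|k IH] M [F [d [p [Ffree p_surj dp dd]]]].
    exists (F 0%N), (submodule (kernel p)), \val, p; split=> //.
      exact: Ffree.
    exact: short_exact_kernel.
  have [j_inj jp _] := short_exact_kernel p_surj.
  set K := submodule (kernel p) in j_inj jp.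
  pose j : {linear K -> _} := \val.
  have [q qE] : exists q : {linear F 1%N -> K}, forall x, j (q x) = d 0%N x.
    by apply: factor_through => // x; apply/jp/dp => //; exists x.
  exists (F 0%N), K, j, p; split=> //; first exact: Ffree.
  (* The sequence shifted by one presents the first syzygy, with augmentation [q]. *)
  apply: IH; exists (F \o S), (fun i => d i.+1), q; split=> //.
  - by move=> i ik; apply: Ffree.
  - move=> z; have /dp[//|x xE] : p (j z) = 0 by apply/jp; exists z.
    by exists x; apply: j_inj; rewrite [LHS]qE.
  - move=> k0 y; rewrite -(dd 0%N _ y)// -qE; split=> [->|]; first exact: linear0.
    by move=> qy0; apply: j_inj; rewrite [LHS]qy0.
  - by move=> i ik; apply: dd.
elim: k M => [|k IH] M [F [K [i [p [Ffree [i_inj ip p_surj] Kk]]]]].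
  (* For k = 0 only the cover [p] is constrained; the other terms and maps are fillers. *)
  by exists (fun=> F), (fun=> \0), p; split.
have [G [d [q [Gfree q_surj dq dd]]]] := IH _ Kk.
pose H j := if j is j'.+1 then G j' else F.
(* The new lowest differential is the composite G 0 -> K -> F. *)
pose d' j : {linear H j.+1 -> H j} :=
  if j is j'.+1 return {linear H j.+1 -> H j} then d j' else i \o q.
exists H, d', p; split=> //.
- by case=> // j; apply: Gfree.
- move=> _ y; rewrite ip; split=> [[x <-]|[x <-]]; last by exists (q x).
  by have [z <-] := q_surj x; exists z.
- case=> [k0|j] /=; last exact: dd.
  move=> y; rewrite -(dq _ y)//=; split=> [iqy0|->]; last exact: linear0.
  by apply: i_inj; rewrite iqy0 linear0.
Qed.

Lemma presentedP (n : nat) (M : lmodType R) :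
  presented (n%:Z - 1) M <-> resolved n M.
Proof.
case: n => // n; rewrite -presented_natP.
by rewrite (_ : n.+1%:Z - 1 = n%:Z)// -addn1 PoszD addrK.
Qed.

End Resolutions.

(** * Base change of linear maps and of free modules *)

Section BaseChange.
Variables (R S : pzRingType) (f : {rmorphism R -> S}).

Lemma base_tens_balanced (M : lmodType R) :
  balanced (fun (s : right_module f) (m : M) => base_tens f s m).
Proof. exact: tens_balanced. Qed.

Lemma base_tens_zmod_morphism (M : lmodType R) (s : S) :
  zmod_morphism (@base_tens R S f M s).
Proof.
have [_ tDr _] := base_tens_balanced M.
by move=> x y; apply: (addIr (base_tens f s y)); rewrite -[LHS]tDr !subrK.
Qed.

HB.instance Definition _ (M : lmodType R) (s : S) :=
  GRing.isZmodMorphism.Build M (base_change f M) (@base_tens R S f M s)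
    (base_tens_zmod_morphism s).

(** Functoriality, with the composite given pointwise as a separate [k], so that [idfun] or a
    simplified map can stand for it. *)
Lemma base_map_comp (M N P : lmodType R) (g : {linear N -> P})
    (h : {linear M -> N}) (k : {linear M -> P}) :
  (forall x, g (h x) = k x) ->
  forall t, base_map f g (base_map f h t) = base_map f k t.
Proof.
move=> ghk; elim/base_change_ind=> [s m|x y xE yE].
  by rewrite !base_map_tens ghk.
by rewrite !linearB /= xE yE.
Qed.

Lemma base_map_bij (M N : lmodType R) (e : {linear M -> N}) :
  bijective e -> bijective (base_map f e).
Proof.
move=> /bijective_inverse[g [eK gK]]; exists (base_map f g) => t.
  rewrite (base_map_comp (k := idfun) eK).
  elim/base_change_ind: t => [s m|x y xE yE]; first by rewrite base_map_tens.
  by rewrite linearB /= xE yE.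
rewrite (base_map_comp (k := idfun) gK).
elim/base_change_ind: t => [s m|x y xE yE]; first by rewrite base_map_tens.
by rewrite linearB /= xE yE.
Qed.

(** The map from S^n is given by the tensors of 1 with the basis vectors; its inverse is induced by
    the balanced map sending (s, x) to the row with entries s f(x_j). *)
Lemma base_change_row n : finitely_generated_free (base_change f 'rV[R]_n).
Proof.
pose b (s : right_module f) (x : 'rV[R]_n) : 'rV[S]_n :=
  \row_j ((s : S) * f (x 0 j)).
have b_bal : balanced b.
  split=> [s s' x|s x x'|r s x]; apply/rowP => j; rewrite !mxE.
  - exact: mulrDl.
  - by rewrite rmorphD mulrDr.
  - by rewrite rmorphM mulrA.
pose g : {additive base_change f 'rV[R]_n -> 'rV[S]_n} :=
  HB.pack_for {additive base_change f 'rV[R]_n -> 'rV[S]_n} (tensor_lift b)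
    (GRing.isZmodMorphism.Build _ _ _ (tensor_lift_is_zmod_morphism b_bal)).
have gE s x : g (base_tens f s x) = b s x by exact: tensor_lift_tens.
pose e := row_comb (fun j => base_tens f 1 (delta_mx 0 j : 'rV[R]_n)).
exists n, e; exists g => [y|].
  rewrite [y in RHS]row_sum_delta raddf_sum; apply: eq_bigr => j _.
  rewrite base_tensZ mulr1 gE; apply/rowP => i; rewrite !mxE.
  by rewrite rmorph_nat.
elim/base_change_ind=> [s x|x y xE yE]; last by rewrite raddfB linearB /= xE yE.
rewrite gE [x in RHS]row_sum_delta raddf_sum; apply: eq_bigr => j _.
rewrite mxE base_tensZ mulr1.
by have [_ _ tZ] := base_tens_balanced 'rV[R]_n; rewrite -[RHS]tZ.
Qed.

Lemma base_change_free (F : lmodType R) :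
  finitely_generated_free F -> finitely_generated_free (base_change f F).
Proof.
move=> [n [e /base_map_bij e_bij]]; have [m [h h_bij]] := base_change_row n.
by exists m, (base_map f e \o h); exact: bij_comp.
Qed.

Lemma base_change_row0 (t : base_change f 'rV[R]_0) : t = 0.
Proof.
elim/base_change_ind: t => [s x|x y -> ->]; last exact: subr0.
by rewrite [x]thinmx0 raddf0.
Qed.

Lemma base_map0 (M N : lmodType R) t : base_map f (\0 : {linear M -> N}) t = 0.
Proof.
elim/base_change_ind: t => [s x|x y xE yE]; last by rewrite linearB /= xE yE subr0.
by rewrite base_map_tens /= raddf0.
Qed.

(** * Exactness and ascent under faithful flatness *)

Hypothesis flatS : faithfully_flat (right_module f).

(** Surjectivity is exactness of M -> N -> 0, with R^0 as the zero module; faithful flatness both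
    preserves and reflects it. *)
Lemma base_map_surj (M N : lmodType R) (p : {linear M -> N}) :
  (forall y, exists x, p x = y) <-> (forall y, exists x, base_map f p x = y).
Proof.
have := flatS p (\0 : {linear N -> 'rV[R]_0}) => -[pE Sp].
split=> [p_surj y|Sp_surj y].
  by apply/pE; [move=> z; split|exact: base_map0].
by apply/Sp => // z; split=> _; [exact: Sp_surj|exact: base_map0].
Qed.

Lemma base_map_inj (M N : lmodType R) (i : {linear M -> N}) :
  injective i -> injective (base_map f i).
Proof.
move=> i_inj; have /flatS Si : exact_at (\0 : {linear 'rV[R]_0 -> M}) i.
  move=> y; split=> [iy0|[x <-]]; last exact: linear0.
  by exists 0; apply: i_inj; rewrite iy0 !linear0.
move=> x y xy; apply/eqP; rewrite -subr_eq0; apply/eqP.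
have /Si[z <-] : base_map f i (x - y) = 0 by rewrite linearB /= xy subrr.
exact: base_map0.
Qed.

Lemma base_short_exact (U V W : lmodType R) (i : {linear U -> V})
    (p : {linear V -> W}) :
  short_exact i p -> short_exact (base_map f i) (base_map f p).
Proof.
move=> [i_inj ip p_surj]; split; first exact: base_map_inj.
  exact/flatS.
exact/base_map_surj.
Qed.

Lemma resolved_base_change k (M : lmodType R) :
  resolved k M -> resolved k (base_change f M).
Proof.
elim: k M => // k IH M [F [K [i [p [Ffree ip Kk]]]]].
exists (base_change f F), (base_change f K), (base_map f i), (base_map f p).
by split; [exact: base_change_free|exact: base_short_exact|exact: IH].
Qed.

(** * Finite free covers and descent *)

Definition covers (N : lmodType R) (t : base_change f N) : Prop :=
  exists (F : lmodType R) (p : {linear F -> N}),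
    finitely_generated_free F /\ exists x, base_map f p x = t.

Lemma cover2 (N F G : lmodType R) (p : {linear F -> N}) (q : {linear G -> N}) :
  finitely_generated_free F -> finitely_generated_free G ->
  exists (H : lmodType R) (r : {linear H -> N}),
    [/\ finitely_generated_free H,
       forall x, exists z, base_map f r z = base_map f p x &
       forall x, exists z, base_map f r z = base_map f q x].
Proof.
move=> Ffree Gfree.
have r_lin : linear (fun z : (F * G)%type => p z.1 + q z.2).
  by move=> a x y; rewrite /= !linearP /= addrACA -scalerDr.
have l_lin : linear (fun x => (x, 0) : (F * G)%type).
  by move=> a x y; congr pair; rewrite /= scaler0 addr0.
have m_lin : linear (fun x => (0, x) : (F * G)%type).
  by move=> a x y; congr pair; rewrite /= scaler0 addr0.
exists (F * G)%type, (linear_of r_lin); split=> [|x|x]; first exact: free_prod.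
- exists (base_map f (linear_of l_lin) x); apply: base_map_comp => y /=.
  by rewrite linear0 addr0.
- exists (base_map f (linear_of m_lin) x); apply: base_map_comp => y /=.
  by rewrite linear0 add0r.
Qed.

(** A pure tensor of s and m comes from the map R -> N sending 1 to m; a difference of tensors uses
    the sum of two covers. *)
Lemma cover1 (N : lmodType R) (t : base_change f N) : covers t.
Proof.
elim/base_change_ind: t => [s m|t u [F [p [Ffree [x <-]]]] [G [q [Gfree [y <-]]]]].
  exists 'rV[R]_1, (row_comb (fun=> m)); split; first exact: free_row.
  exists (base_tens f s (const_mx 1)); rewrite base_map_tens /=; congr base_tens.
  by rewrite /row_comb big_ord1 mxE scale1r.
have [H [r [Hfree /(_ x)[z <-] /(_ y)[w <-]]]] := cover2 p q Ffree Gfree.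
by exists H, r; split=> //; exists (z - w); rewrite linearB.
Qed.

Lemma cover_finite (N : lmodType R) n (t : 'I_n -> base_change f N) :
  exists (F : lmodType R) (p : {linear F -> N}),
    finitely_generated_free F /\ forall j, exists x, base_map f p x = t j.
Proof.
elim: n t => [|n IH] t.
  by exists 'rV[R]_0, \0; split=> [|[]//]; exact: free_row.
have [F [p [Ffree pE]]] := IH (fun j => t (lift ord0 j)).
have [G [q [Gfree [y yE]]]] := cover1 (t ord0).
have [H [r [Hfree rp rq]]] := cover2 p q Ffree Gfree.
exists H, r; split=> // j; case: (unliftP ord0 j) => [j' ->|->].
  by have [x <-] := pE j'; exact: rp.
by rewrite -yE; exact: rq.
Qed.

Lemma base_change_resolved k (M : lmodType R) :
  resolved k (base_change f M) -> resolved k M.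
Proof.
elim: k M => // k IH M SM.
have [F [K [i [q [[n [e [e' _ e'K]]] [_ _ q_surj] _]]]]] := SM.
(* The images of the basis vectors generate the base change of [M], so reaching these finitely many
   suffices for surjectivity. *)
have [G [p [Gfree pE]]] := cover_finite (fun j => q (e (delta_mx 0 j))).
have p_surj : forall y, exists x, p x = y.
  apply/base_map_surj => y; have [z <-] := q_surj y; have /choice[w wE] := pE.
  exists (row_comb w (e' z)); rewrite -[in RHS](e'K z).
  rewrite -[RHS]/((q \o e) (e' z)) [RHS]linear_row_comb /= linear_sum.
  by apply: eq_bigr => j _; rewrite linearZ /= wE.
have ip := short_exact_kernel p_surj.
exists G, (submodule (kernel p)), \val, p; split=> //; apply: IH.
(* By flatness the base change of the kernel of [p] is the kernel of the tensored cover, to which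
   Schanuel's argument applies. *)
by apply: resolved_syzygy (base_short_exact ip) SM; exact: base_change_free.
Qed.

(** Flatness makes the map from the base change of [N] to that of [M] injective, hence an
    isomorphism onto its image [base_submodule f N]; ascent and descent then apply. *)
Lemma resolved_base_submodule k (M : lmodType R) (N : submodClosed M) :
  resolved k (submodule (base_submodule f N)) <-> resolved k (submodule N).
Proof.
pose i := base_map f (\val : submodule N -> M).
have i_inj : injective i by apply: base_map_inj; exact: val_inj.
have [e eE] : exists e : {linear base_change f (submodule N) ->
    submodule (base_submodule f N)}, forall t, \val (e t) = i t.
  apply: factor_through => [|t]; first exact: val_inj.
  have tP : i t \in base_submodule f N by apply/asboolP; exists t.
  by exists (Submodule tP).
have e_bij : bijective e.
  apply: bijectiveP => [x y /(congr1 \val)|y]; first by rewrite !eE => /i_inj.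
  have /asboolP[x xE] := valP y.
  by exists x; apply: val_inj; rewrite eE.
split=> [/(resolved_iso _)|] Nk; last first.
  by apply: resolved_iso e_bij _; exact: resolved_base_change.
have [g [eK gK]] := bijective_inverse e_bij.
apply: base_change_resolved; apply: (Nk _ g); exact: Bijective gK eK.
Qed.

End BaseChange.

(** * Transfer of coherence *)

Theorem theorem2p14 (R S : pzRingType) (f : {rmorphism R -> S})
    (flatS : faithfully_flat (right_module f))
    (n : nat) (M : lmodType R) (X : set (submodClosed M)) :
  (coherent n (base_change_class f X) -> coherent n X) /\
  (coherent n X <->
   coherent n (base_change_class f (presented_class X (n%:Z - 1)))).
Proof.
have SP k (N : submodClosed M) :
    presented k (submodule (base_submodule f N)) <-> presented k (submodule N).
  (* For negative [k] both sides are trivially true. *)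
  by case: k => // k; rewrite /presented !presented_natP; exact: resolved_base_submodule.
(* The class [Y] is arbitrary because it is taken to be X for (1) and X_{n-1} for the converse half
   of (2). *)
have descent (Y : set (submodClosed M)) : coherent n (base_change_class f Y) -> coherent n Y.
  move=> [[_ [[N YN <-] /SP Nn]] SY]; split; first by exists N.
  move=> N' [YN' N'n]; split=> //; apply/SP.
  by apply: (SY (base_submodule f N') _).2; split; [exists N'|exact/SP].
split; first exact: descent.
split=> [[[N XN] XX]|/descent[[N [XN _]] XX]].
  split; first by eexists; split; [exists N|exact/SP/XN.2].
  by move=> _ [[N' N'X <-] _]; split; [exists N'|exact/SP/(XX _ N'X).2].
split; first by exists N.
(* Members of X_{n-1} are already (n-1)-presented, so restricting that class to its (n-1)-presented
   members changes nothing. *)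
by move=> N' N'X; have [] := XX N' (conj N'X N'X.2); split; first exact: N'X.1.
Qed.
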